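(* Let $m\ge 0$ and $r\ge 1$ be integers. The sequential $m$-discrete topological complexity is an invariant of strong homotopy type: if simplicial complexes $K$ and $K'$ have the same strong homotopy type, then $\mathrm{TC}_r^m(K)=\mathrm{TC}_r^m(K')$.
   Context: Simplicial complexes are abstract simplicial complexes; the complexes $K,K'$ are assumed edge-path connected (any two vertices are joined by a finite chain of edges). Subcomplexes used in coverings and the test complexes $P$ below need not be connected. Two simplicial maps $\varphi,\psi:A\to B$ are contiguous, $\varphi\sim_c\psi$, if for every simplex $\{v_0,\dots,v_k\}$ of $A$ the set $\{\varphi(v_0),\dots,\varphi(v_k),\psi(v_0),\dots,\psi(v_k)\}$ is a simplex of $B$. They are in the same contiguity class, $\varphi\sim\psi$, if there is a finite sequence of simplicial maps $A\to B$ starting at $\varphi$ and ending at $\psi$ in which consecutive maps are contiguous. $K$ and $K'$ have the same strong homotopy type if there are simplicial maps $\varphi:K\to K'$ and $\psi:K'\to K$ with $\varphi\circ\psi\sim\mathrm{id}_{K'}$ and $\psi\circ\varphi\sim\mathrm{id}_K$. $K^r$ denotes the $r$-fold categorical product: its vertices are $r$-tuples of vertices of $K$, and a finite nonempty set of such tuples is a simplex iff for each coordinate the set of its coordinate entries is a simplex of $K$. The sequential $m$-discrete topological complexity $\mathrm{TC}_r^m(K)$ is the least integer $k\ge 0$ such that $K^r$ can be covered by subcomplexes $\Omega_0,\dots,\Omega_k$, for each of which there exists a simplicial map $\sigma_j:\Omega_j\to K$ such that for every simplicial map $\eta:P\to\Omega_j$ from an $m$-dimensional simplicial complex $P$ one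 has $\Delta\circ\sigma_j\circ\eta\sim\iota_j\circ\eta$, where $\iota_j:\Omega_j\hookrightarrow K^r$ is the inclusion and $\Delta:K\to K^r$ is the diagonal map; it is $\infty$ if there is no such covering. *)

(* Defs.v *)
From mathcomp Require Import all_boot finmap.
From mathcomp Require Import boolp classical_sets.

Set Implicit Arguments.
Unset Strict Implicit.
Unset Printing Implicit Defensive.

Local Open Scope fset_scope.

(* Every element of the carrier is a vertex; there are no finiteness
   assumptions, and the empty complex is allowed.  Requiring the carrier to be a
   choiceType is no restriction classically. *)
Record complex := Complex {
  vertex :> choiceType;
  simplex : set {fset vertex};
  simplex_neq0 : forall s, simplex s -> s != fset0;
  simplex_face : forall s t, simplex s -> t != fset0 -> t `<=` s -> simplex t;
  simplex_vertex : forall v, simplex [fset v] }.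

Definition edge (K : complex) (v w : K) : Prop :=
  v <> w /\ simplex [fset v; w].

Definition edge_path_connected (K : complex) : Prop :=
  forall v w : K, exists (n : nat) (p : nat -> K),
    [/\ p 0 = v, p n = w & forall i, i < n -> edge (p i) (p i.+1)].

Definition has_dimension (m : nat) (K : complex) : Prop :=
  (exists2 s : {fset K}, simplex s & #|` s| = m.+1) /\
  (forall s : {fset K}, simplex s -> #|` s| <= m.+1).

Record simplicial_map (A B : complex) := SimplicialMap {
  map_vertex :> A -> B;
  map_simplex : forall s, simplex s -> simplex [fset map_vertex v | v in s] }.

Lemma id_simplex (A : complex) (s : {fset A}) :
  simplex s -> simplex [fset id v | v in s].
Proof. by rewrite imfset_id. Qed.

Definition smap_id (A : complex) : simplicial_map A A :=
  SimplicialMap (@id_simplex A).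

Lemma comp_simplex (A B C : complex) (g : simplicial_map B C)
    (f : simplicial_map A B) (s : {fset A}) :
  simplex s -> simplex [fset (g \o f) v | v in s].
Proof.
by move=> ss; rewrite (imfset_comp _ f g); do 2!apply: map_simplex.
Qed.

Definition smap_comp (A B C : complex) (g : simplicial_map B C)
    (f : simplicial_map A B) : simplicial_map A C :=
  SimplicialMap (@comp_simplex A B C g f).

Definition contiguous (A B : complex) (f g : simplicial_map A B) : Prop :=
  forall s : {fset A}, simplex s ->
    simplex ([fset f v | v in s] `|` [fset g v | v in s]).

Definition same_contiguity_class (A B : complex) (f g : simplicial_map A B) :
    Prop :=
  exists (n : nat) (h : nat -> simplicial_map A B),
    [/\ h 0 = f, h n = g & forall i, i < n -> contiguous (h i) (h i.+1)].

Definition same_strong_homotopy_type (K K' : complex) : Prop :=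
  exists (f : simplicial_map K K') (g : simplicial_map K' K),
    same_contiguity_class (smap_comp f g) (smap_id K') /\
    same_contiguity_class (smap_comp g f) (smap_id K).

Section Product.
Variables (r : nat) (K : complex).

(* The nonemptiness condition is redundant unless r = 0. *)
Definition prod_simplex : set {fset r.-tuple K} := fun s =>
  s != fset0 /\ forall i : 'I_r, simplex [fset tnth t i | t in s].

Lemma prod_simplex_neq0 s : prod_simplex s -> s != fset0.
Proof. by case. Qed.

Lemma prod_simplex_face s t :
  prod_simplex s -> t != fset0 -> t `<=` s -> prod_simplex t.
Proof.
move=> [_ hs] t0 ts; split=> // i; apply: (simplex_face (hs i)).
  case/fset0Pn: t0 => x xt; apply/fset0Pn; exists (tnth x i).
  by apply: in_imfset.
by apply: subset_imfset => x; apply: (fsubsetP ts).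
Qed.

Lemma prod_simplex_vertex v : prod_simplex [fset v].
Proof.
split; first by apply/fset0Pn; exists v; rewrite inE.
by move=> i; rewrite imfset_fset1; apply: simplex_vertex.
Qed.

Definition power : complex :=
  Complex prod_simplex_neq0 prod_simplex_face prod_simplex_vertex.

Lemma diag_simplex (s : {fset K}) :
  simplex s -> @simplex power [fset [tuple v | _ < r] | v in s].
Proof.
move=> ss; split=> [|i].
  case/fset0Pn: (simplex_neq0 ss) => x xs; apply/fset0Pn.
  by exists [tuple x | _ < r]; apply: in_imfset.
rewrite -imfset_comp (_ : _ @` _ = s) // -[RHS]imfset_id.
by apply: eq_imfset => // x /=; rewrite tnth_mktuple.
Qed.

Definition diagonal : simplicial_map K power := SimplicialMap diag_simplex.

End Product.

Record subcomplex (K : complex) := Subcomplex {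
  sub_simplex : set {fset K};
  sub_simplexP : forall s, sub_simplex s -> simplex s;
  sub_simplex_face : forall s t,
    sub_simplex s -> t != fset0 -> t `<=` s -> sub_simplex t }.

(* A subcomplex as a complex in its own right: its vertices are only those v
   for which {v} is one of its simplices. *)
Section ComplexOfSubcomplex.
Variables (K : complex) (L : subcomplex K).

Definition sub_vertex : set K := fun v => sub_simplex L [fset v].

Definition csub_simplex : set {fset sub_vertex} := fun s =>
  sub_simplex L [fset val v | v in s].

Lemma csub_simplex_neq0 s : csub_simplex s -> s != fset0.
Proof.
move=> /sub_simplexP /simplex_neq0 /fset0Pn[x /imfsetP[y /= ys _]].
by apply/fset0Pn; exists y.
Qed.

Lemma csub_simplex_face s t :
  csub_simplex s -> t != fset0 -> t `<=` s -> csub_simplex t.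
Proof.
move=> hs t0 ts; apply: (sub_simplex_face hs).
  case/fset0Pn: t0 => x xt; apply/fset0Pn; exists (val x).
  by apply: in_imfset.
by apply: subset_imfset => x; apply: (fsubsetP ts).
Qed.

Lemma csub_simplex_vertex v : csub_simplex [fset v].
Proof. by rewrite /csub_simplex imfset_fset1; apply: (set_mem (valP v)). Qed.

Definition complex_of_subcomplex : complex :=
  Complex csub_simplex_neq0 csub_simplex_face csub_simplex_vertex.

Lemma incl_simplex (s : {fset complex_of_subcomplex}) :
  simplex s -> simplex [fset (val v : K) | v in s].
Proof. exact: sub_simplexP. Qed.

Definition inclusion : simplicial_map complex_of_subcomplex K :=
  SimplicialMap incl_simplex.

End ComplexOfSubcomplex.

Coercion complex_of_subcomplex : subcomplex >-> complex.

Definition covers (K : complex) (n : nat) (Omega : 'I_n -> subcomplex K) :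
    Prop :=
  forall s : {fset K}, simplex s -> exists j, sub_simplex (Omega j) s.

Definition m_motion_planner (r m : nat) (K : complex)
    (Omega : subcomplex (power r K)) : Prop :=
  exists sigma : simplicial_map Omega K,
    forall (P : complex) (eta : simplicial_map P Omega), has_dimension m P ->
      same_contiguity_class
        (smap_comp (diagonal r K) (smap_comp sigma eta))
        (smap_comp (inclusion Omega) eta).

Definition TC_le (r m : nat) (K : complex) (k : nat) : Prop :=
  exists Omega : 'I_k.+1 -> subcomplex (power r K),
    covers Omega /\ forall j, m_motion_planner m (Omega j).

(* [Some k] is the finite value k and [None] is the value infinity. *)
Definition TC (r m : nat) (K : complex) : option nat :=
  match pselect (exists k, `[< TC_le r m K k >]) with
  | left exk => Some (ex_minn exk)
  | right _ => None
  end.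

(* Main.v *)
(* If f : K -> K' and g : K' -> K satisfy f g ~ id, a motion planner sigma over
   Omega in K^r yields the motion planner f sigma g^r over the preimage of Omega
   under g^r, because
     Delta f sigma g^r eta = f^r Delta sigma (g^r eta)
                           ~ f^r iota (g^r eta) = (f g)^r iota' eta ~ iota' eta.
   Preimages of a covering of K^r cover K'^r, so TC_r^m(K') <= TC_r^m(K) as soon
   as K' is dominated by K; the theorem is this inequality used both ways. *)
Require Import Defs.
From mathcomp Require Import all_boot.
From mathcomp Require Import finmap.
From mathcomp Require Import boolp classical_sets.

Set Implicit Arguments.
Unset Strict Implicit.
Unset Printing Implicit Defensive.

Local Open Scope fset_scope.

(** Proof irrelevance discards the simpliciality proofs, so identities between composites become
    Leibniz equalities that can be used for rewriting. *)
Lemma simplicial_map_eq (A B : complex) (f g : simplicial_map A B) :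
  f =1 g -> f = g.
Proof.
case: f g => f hf [g hg] /= /funext fg; subst g.
by congr SimplicialMap; apply: Prop_irrelevance.
Qed.

Lemma same_contiguity_class_trans (A B : complex)
    (g f h : simplicial_map A B) :
  same_contiguity_class f g -> same_contiguity_class g h ->
  same_contiguity_class f h.
Proof.
move=> [n [p [p0 pn hp]]] [k [q [q0 qk hq]]].
(* The chains are glued at index [n], whose value is read from [q]; for [n = 0] the start is
   [q 0 = g = p 0 = f]. *)
exists (n + k)%N, (fun i => if i < n then p i else q (i - n)); split.
- by case: n pn {hp} => [|n] pn; rewrite /= ?subn0 ?q0 -?pn ?p0.
- by rewrite ltnNge leq_addr /= addKn.
- move=> i ik; case: (ltnP i n) => lin.
    case: (ltnP i.+1 n) => [_|lni]; first exact: hp.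
    (* The step across the seam is the last step of [p], because [q 0 = p n]. *)
    have eSi : i.+1 = n by apply/eqP; rewrite eqn_leq lin.
    by rewrite eSi subnn q0 -pn -eSi; apply: hp.
  rewrite ltnNge (leq_trans lin) //= subSn //.
  by apply: hq; rewrite ltn_subLR.
Qed.

Lemma imfset_smap_comp (A B C : complex) (g : simplicial_map B C)
    (f : simplicial_map A B) (s : {fset A}) :
  [fset smap_comp g f v | v in s] = [fset g w | w in [fset f v | v in s]].
Proof. by rewrite -imfset_comp. Qed.

Lemma same_contiguity_class_compl (A B C : complex) (u : simplicial_map B C)
    (f g : simplicial_map A B) :
  same_contiguity_class f g ->
  same_contiguity_class (smap_comp u f) (smap_comp u g).
Proof.
move=> [n [p [p0 pn hp]]]; exists n, (fun i => smap_comp u (p i)).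
split; rewrite ?p0 ?pn // => i lin s ss.
rewrite !imfset_smap_comp -imfsetU.
by apply: map_simplex; apply: hp.
Qed.

Lemma same_contiguity_class_compr (A B C : complex) (u : simplicial_map A B)
    (f g : simplicial_map B C) :
  same_contiguity_class f g ->
  same_contiguity_class (smap_comp f u) (smap_comp g u).
Proof.
move=> [n [p [p0 pn hp]]]; exists n, (fun i => smap_comp (p i) u).
split; rewrite ?p0 ?pn // => i lin s ss.
by rewrite !imfset_smap_comp; apply: hp => //; apply: map_simplex.
Qed.

Section PowerMap.
Variable r : nat.

Lemma imfset_tnth_map (A B : complex) (f : A -> B) (s : {fset r.-tuple A})
    (i : 'I_r) :
  [fset tnth t i | t in [fset map_tuple f t | t in s]] =
  [fset f v | v in [fset tnth t i | t in s]].
Proof.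
by rewrite -!imfset_comp; apply: eq_imfset => // t /=; rewrite tnth_map.
Qed.

Lemma power_map_simplex {A B : complex} (f : simplicial_map A B)
    (s : {fset power r A}) :
  simplex s -> @simplex (power r B) [fset map_tuple f t | t in s].
Proof.
move=> [s0 hs]; split=> [|i].
  by case/fset0Pn: s0 => x xs; apply/fset0Pn; exists (map_tuple f x);
    apply: in_imfset.
by rewrite imfset_tnth_map; apply: map_simplex.
Qed.

Definition power_map {A B : complex} (f : simplicial_map A B) :
    simplicial_map (power r A) (power r B) :=
  SimplicialMap (power_map_simplex f).

Lemma power_map_id (A : complex) :
  power_map (smap_id A) = smap_id (power r A).
Proof.
by apply: simplicial_map_eq => t; apply: eq_from_tnth => i /=; rewrite tnth_map.
Qed.

Lemma power_map_comp (A B C : complex) (g : simplicial_map B C)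
    (f : simplicial_map A B) :
  power_map (smap_comp g f) = smap_comp (power_map g) (power_map f).
Proof.
by apply: simplicial_map_eq => t; apply: eq_from_tnth => i /=; rewrite !tnth_map.
Qed.

Lemma power_map_diagonal (A B : complex) (f : simplicial_map A B) :
  smap_comp (power_map f) (Defs.diagonal r A) = smap_comp (Defs.diagonal r B) f.
Proof.
apply: simplicial_map_eq => t; apply: eq_from_tnth => i /=.
by rewrite tnth_map !tnth_mktuple.
Qed.

(** Simplices of a power are tested coordinatewise, and in each coordinate the condition is
    contiguity of consecutive maps of the given chain. *)
Lemma same_contiguity_class_power (A B : complex) (f g : simplicial_map A B) :
  same_contiguity_class f g ->
  same_contiguity_class (power_map f) (power_map g).
Proof.
move=> [n [p [p0 pn hp]]]; exists n, (fun i => power_map (p i)).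
split; rewrite ?p0 ?pn // => i lin s [s0 hs]; split=> [|j].
  case/fset0Pn: s0 => x xs; apply/fset0Pn; exists (map_tuple (p i) x).
  by rewrite in_fsetU; apply/orP; left; apply: in_imfset.
by rewrite imfsetU !imfset_tnth_map; apply: hp.
Qed.

End PowerMap.

Section Preimage.
Variables (A B : complex) (f : simplicial_map A B) (L : subcomplex B).

(** A set whose image under [f] is a simplex need not be one itself, hence the first conjunct. *)
Definition preimage_simplex : set {fset A} := fun s =>
  simplex s /\ sub_simplex L [fset f v | v in s].

Lemma preimage_simplexP s : preimage_simplex s -> simplex s.
Proof. by case. Qed.

Lemma preimage_simplex_face s t :
  preimage_simplex s -> t != fset0 -> t `<=` s -> preimage_simplex t.
Proof.
move=> [ss hs] t0 ts; split; first exact: simplex_face ss t0 ts.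
apply: (sub_simplex_face hs).
  by case/fset0Pn: t0 => x xt; apply/fset0Pn; exists (f x); apply: in_imfset.
by apply: subset_imfset => x; apply: (fsubsetP ts).
Qed.

Definition preimage_subcomplex : subcomplex A :=
  Subcomplex preimage_simplexP preimage_simplex_face.

Lemma preimage_vertex (v : preimage_subcomplex) :
  f (val v) \in sub_vertex L.
Proof. by case: (set_mem (valP v)) => _; rewrite imfset_fset1 => /mem_set. Qed.

(** The restriction of [f], with values in [L] as a complex in its own right, so that a planner on
    [L] can be composed with it. *)
Definition preimage_map_vertex (v : preimage_subcomplex) : L :=
  exist _ (f (val v)) (preimage_vertex v).

Lemma preimage_map_simplex (s : {fset preimage_subcomplex}) :
  simplex s -> @simplex L [fset preimage_map_vertex v | v in s].
Proof.
move=> [_]; rewrite /= /csub_simplex -!imfset_comp.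
by congr sub_simplex; apply: eq_imfset.
Qed.

Definition preimage_map : simplicial_map preimage_subcomplex L :=
  SimplicialMap preimage_map_simplex.

Lemma inclusion_preimage_map :
  smap_comp (inclusion L) preimage_map =
  smap_comp f (inclusion preimage_subcomplex).
Proof. exact: simplicial_map_eq. Qed.

End Preimage.

Lemma smap_compA (A B C D : complex) (h : simplicial_map C D)
    (g : simplicial_map B C) (f : simplicial_map A B) :
  smap_comp h (smap_comp g f) = smap_comp (smap_comp h g) f.
Proof. exact: simplicial_map_eq. Qed.

Lemma smap_comp1 (A B : complex) (f : simplicial_map A B) :
  smap_comp (smap_id B) f = f.
Proof. exact: simplicial_map_eq. Qed.

Section Domination.
Variables (r m : nat) (K K' : complex).
Variables (f : simplicial_map K K') (g : simplicial_map K' K).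
Hypothesis fg_id : same_contiguity_class (smap_comp f g) (smap_id K').

Lemma m_motion_planner_preimage (L : subcomplex (power r K)) :
  m_motion_planner m L ->
  m_motion_planner m (preimage_subcomplex (power_map r g) L).
Proof.
set gL := preimage_map (power_map r g) L => -[sigma hsigma].
exists (smap_comp f (smap_comp sigma gL)) => P eta dimP.
(* The planner on [L] is tested on [gL] after [eta], a map from the same [P], and the result is
   pushed forward along [f^r]. *)
have := same_contiguity_class_compl (power_map r f)
  (hsigma P (smap_comp gL eta) dimP).
(* Naturality of the diagonal gives the left end the required form; the right end becomes [(f g)^r]
   after the inclusion of the preimage and [eta]. *)
rewrite !smap_compA power_map_diagonal -(smap_compA _ (inclusion L)).
rewrite inclusion_preimage_map smap_compA -power_map_comp.
move/same_contiguity_class_trans; apply.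
(* Cancelling [eta] and then the inclusion leaves [(f g)^r ~ id]. *)
apply: same_contiguity_class_compr; rewrite -[X in same_contiguity_class _ X]smap_comp1.
apply: same_contiguity_class_compr; rewrite -power_map_id.
exact: same_contiguity_class_power.
Qed.

Lemma TC_le_dominated k : TC_le r m K k -> TC_le r m K' k.
Proof.
move=> [Omega [covO plan]].
exists (fun j => preimage_subcomplex (power_map r g) (Omega j)).
split=> [s ss|j]; last exact/m_motion_planner_preimage.
(* The piece containing the image of [s] under [g^r] has a preimage containing [s]. *)
have [j Oj] := covO _ (map_simplex (power_map r g) ss).
by exists j; split.
Qed.

End Domination.

Unset Implicit Arguments.

Theorem corollary6p2 (m r : nat) (r_ge1 : 1 <= r) (K K' : complex)
    (K_connected : edge_path_connected K)
    (K'_connected : edge_path_connected K') :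
  same_strong_homotopy_type K K' -> TC r m K = TC r m K'.
Proof.
move=> [f [g [fg gf]]].
(* Equal predicates have the same minimum or are both empty, so the finite and infinite values need
   no separate treatment. *)
have TC_leE : TC_le r m K = TC_le r m K'.
  apply/funext => k; apply/propext.
  by split; [exact: (TC_le_dominated fg) | exact: (TC_le_dominated gf)].
by rewrite /TC TC_leE.
Qed.
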